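(* If $\mathfrak b=\mathfrak c$, then there are continuum many pairwise distinct large finitary coarse structures on $\omega$.
   Context: An entourage on a set $X$ is a set $E\subseteq X\times X$ containing the diagonal $\Delta_X$; $E^{-1}=\{(y,x):(x,y)\in E\}$, $EF=\{(x,z):\exists y\ (x,y)\in E,(y,z)\in F\}$, $E(x)=\{y:(x,y)\in E\}$, $E[A]=\bigcup_{a\in A}E(a)$. A coarse structure on $X$ is a family $\mathcal E$ of entourages on $X$ such that $\bigcup\mathcal E=X\times X$; for any $E,F\in\mathcal E$ there is $T\in\mathcal E$ with $EF^{-1}\subseteq T$; and every entourage contained in a member of $\mathcal E$ belongs to $\mathcal E$. It is finitary if $\sup_{x\in X}|E(x)|$ is finite for every $E\in\mathcal E$. A set $A\subseteq X$ is $\mathcal E$-bounded if $A\subseteq E(x)$ for some $E\in\mathcal E$, $x\in X$, and $\mathcal E$-unbounded otherwise. A coarse structure for which $X$ is $\mathcal E$-unbounded is large if for every $\mathcal E$-unbounded set $A\subseteq X$ there is $E\in\mathcal E$ with $E[A]=X$. $\mathfrak b$ is the smallest cardinality of an unbounded subset of $(\omega^\omega,\le^* )$, where $f\le^* g$ means $f(n)\le g(n)$ for all but finitely many $n$; $\mathfrak c=2^{\aleph_0}$. *)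

(* Defs.v *)
From mathcomp Require Import all_boot.
From mathcomp Require Import boolp classical_sets functions cardinality.

Set Implicit Arguments.
Unset Strict Implicit.
Unset Printing Implicit Defensive.

Local Open Scope classical_set_scope.
Local Open Scope card_scope.
Local Open Scope relation_scope.

(** * Coarse structures

    Beware that MathComp composes from right to left: [B \; A] relates x to z
    when A x y and B y z for some y, so that the entourage E F^-1 =
    {(x, z) : exists y, (x, y) in E and (z, y) in F} is [F^-1 \; E].
    The ball E(x) is [xsection E x]. *)

Section Coarse.
Variable X : Type.
Implicit Types (E F T : set (X * X)) (C : set (set (X * X))) (A : set X).

Definition is_entourage E : Prop := diagonal `<=` E.

Definition ball_of_set E A : set X := \bigcup_(a in A) xsection E a.

Record is_coarse_structure C : Prop := IsCoarseStructure {
  coarse_entourage : forall E, C E -> is_entourage E;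
  coarse_cover : \bigcup_(E in C) E = [set: X * X];
  coarse_comp : forall E F, C E -> C F -> exists2 T, C T & F^-1 \; E `<=` T;
  coarse_down : forall E F, C E -> is_entourage F -> F `<=` E -> C F }.

Definition finitary C : Prop :=
  forall E, C E -> exists n : nat, forall x : X, xsection E x #<= `I_n.

Definition coarse_bounded C A : Prop :=
  exists2 E, C E & exists x : X, A `<=` xsection E x.

Definition large C : Prop :=
  ~ coarse_bounded C [set: X] /\
  forall A, ~ coarse_bounded C A ->
    exists2 E, C E & ball_of_set E A = [set: X].

End Coarse.

(** * The cardinals b and c

    Cardinals are represented by sets up to equipotence. *)

Definition le_star (f g : nat -> nat) : Prop :=
  finite_set [set n | ~ (f n <= g n)%N].

Definition star_unbounded (U : set (nat -> nat)) : Prop :=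
  ~ exists g : nat -> nat, forall f, U f -> le_star f g.

(* |K| = b: |K| is the least cardinality of an unbounded subset of
   (omega^omega, <=^* ). *)
Definition has_card_b (T : Type) (K : set T) : Prop :=
  (exists2 U, star_unbounded U & U #= K) /\
  (forall U, star_unbounded U -> K #<= U).

(* A representative of c = 2^aleph_0. *)
Definition continuum : set (set nat) := [set: set nat].

(* Main.v *)
Require Import Defs.
From Stdlib Require Inverse_Image.
From mathcomp Require Import all_boot.
From mathcomp Require Import zify.
From mathcomp Require Import boolp classical_sets functions cardinality wochoice.

(** Choosing any bounded-degree symmetric graphs on nat as generators gives a
    finitary coarse structure: its entourages are the relations contained in
    walks of bounded length through finitely many of the graphs.  The
    generators used here are finite cliques, which make the structure cover
    all pairs, and ladders: for an injective sequence a, the ladder has the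
    rungs n -- a n.  If a takes its values in A, the ladder moves A onto the
    whole of nat in one step.  In a finitary structure bounded sets are
    finite, so one ladder inside every infinite set A gives a large structure
    ([ladder_coarse_large]).

    It suffices to show that a family K of fewer than c large finitary
    structures never exhausts all of them ([large_finitary_outside]); then c
    injects into the set of all of them.  Each C in K has an entourage
    relating infinitely many x to some y <> x, with the larger of x and y
    bounded by a function b_C of the smaller ([large_moves]).  The ladders
    are chosen so that the new structure contains no such entourage, for any
    C in K at once.  To this end well-order the sets of naturals so that every
    initial segment has fewer than c elements ([small_initial_segments]) and
    choose the sequences a_A by recursion.  As b = c, fewer than c functions
    have a common <=*-bound, so there is phi dominating all b_C and all
    earlier a_A', and a_A can be taken much sparser than phi
    ([ladder_system_exists]).

    Sparseness is exploited in [remove_rungs].  Consider a walk of length l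
    whose ends are phi-close to each other, and let n -- a n be the highest
    rung of the sparsest ladder in it.  Either the walk can be shortened so as
    not to use this rung, or one of its ends is linked to n and the other to
    a n by walks that avoid it and are no longer.  All other edges are lower rungs
    or dominated by phi, so the first end stays within reach of n and the
    lower rungs while the second stays close to a n, which is far beyond:
    the ends cannot be phi-close.  Hence only boundedly many low rungs matter,
    and those fit in a finite clique.  Removing the ladders one by one, the sparsest first
    ([remove_all_rungs]), leaves a walk inside a finite clique, which moves
    only finitely many points. *)

Set Implicit Arguments.
Unset Strict Implicit.
Unset Printing Implicit Defensive.

Local Open Scope classical_set_scope.
Local Open Scope card_scope.

(** * Walks of a given length *)

Fixpoint walk T (e : T -> T -> Prop) k x y : Prop :=
  if k is k'.+1 then exists2 z, e x z & walk e k' z y else x = y.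

Lemma sub_walk T (e f : T -> T -> Prop) k x y :
  (forall u v, e u v -> f u v) -> walk e k x y -> walk f k x y.
Proof.
move=> ef; elim: k x => //= k IH x [z xz zy].
by exists z; [exact: ef|exact: IH].
Qed.

Lemma walk_cat T (e : T -> T -> Prop) k l x y z :
  walk e k x y -> walk e l y z -> walk e (k + l) x z.
Proof.
elim: k x => [|k IH] x /=; first by move->.
by case=> w xw wy yz; exists w => //; exact: IH.
Qed.

Lemma walk_sym T (e : T -> T -> Prop) k x y :
  (forall u v, e u v -> e v u) -> walk e k x y -> walk e k y x.
Proof.
move=> es; elim: k x => [|k IH] x //= [z xz zy].
have := walk_cat (IH _ zy) (_ : walk e 1 z x).
by rewrite addn1; apply; exists x => //; exact: es.
Qed.

Lemma walk_leq T (e : T -> T -> Prop) k l x y :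
  (forall u, e u u) -> k <= l -> walk e k x y -> walk e l x y.
Proof.
move=> er /subnKC <- xy; apply: walk_cat xy _.
by elim: (l - k) => //= n IH; exists y.
Qed.

(** A walk that uses the added edge uv several times can be shortcut: only its
    first entry into the edge and its last exit matter, and if these happen at
    the same vertex the edge can be avoided altogether. *)
Lemma walk_add_edge T (e : T -> T -> Prop) u v k x y :
    (forall z, e z z) ->
    walk (fun p q => e p q \/ (p = u /\ q = v) \/ (p = v /\ q = u)) k x y ->
  [\/ walk e k x y, walk e k x u /\ walk e k v y
    | walk e k x v /\ walk e k u y].
Proof.
move=> er; have weak n p q : walk e n p q -> walk e n.+1 p q.
  by apply: walk_leq.
have stay n p : walk e n.+1 p p by apply: (@walk_leq _ e 0).
elim: k x => [|k IH] x /=; first by constructor 1.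
case=> z + /IH {IH}; case=> [xz|[[-> ->]|[-> ->]]].
- case=> [zy|[zu vy]|[zv uy]].
  + by constructor 1; exists z.
  + by constructor 2; split; [exists z|exact: weak].
  + by constructor 3; split; [exists z|exact: weak].
- case=> [vy|[_ vy]|[_ uy]].
  + by constructor 2; split; [exact: stay|exact: weak].
  + by constructor 2; split; [exact: stay|exact: weak].
  + by constructor 1; exact: weak.
- case=> [uy|[_ vy]|[_ uy]].
  + by constructor 3; split; [exact: stay|exact: weak].
  + by constructor 1; exact: weak.
  + by constructor 3; split; [exact: stay|exact: weak].
Qed.

(** The bound w absorbs both the starting point and the exceptional edges,
    those that jump further than g but not beyond M. *)
Lemma walk_bound (e : nat -> nat -> Prop) (g : nat -> nat) M k x y w :
    {homo g : p q / p <= q} -> (forall p, p <= g p) ->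
    (forall p q, e p q -> q <= maxn (g p) M) ->
  x <= w -> M <= w -> walk e k x y -> y <= iter k g w.
Proof.
move=> gm gi eg; elim: k x w => [|k IH] x w xw Mw /=; first by move<-.
case=> z /eg xz zy; rewrite -iterS iterSr; apply: IH zy.
  apply: leq_trans xz _; rewrite geq_max gm //=.
  exact: leq_trans Mw (gi _).
exact: leq_trans Mw (gi _).
Qed.

Lemma leq_iter (g h : nat -> nat) k l w :
    {homo h : p q / p <= q} -> (forall p, p <= h p) ->
    (forall p, g p <= h p) -> k <= l ->
  iter k g w <= iter l h w.
Proof.
move=> hm hi gh /subnKC <-; rewrite addnC iterD.
have le : iter k g w <= iter k h w.
  by elim: k => //= k IH; apply: leq_trans (gh _) _; exact: hm.
apply: leq_trans le _; elim: (l - k) => //= n IH.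
exact: leq_trans IH (hi _).
Qed.

(** * Sparse ladders *)

(** The sum bounds all earlier terms, so a n cannot be reached from n and the
    rungs below it by n applications of phi, even if phi is first increased
    by the constant n.  Letting both the number of steps and the constant grow
    with n defeats every fixed length and every fixed constant eventually. *)
Definition sparse (phi a : nat -> nat) : Prop :=
  forall n, iter n (fun x => phi x + n) (n + \sum_(k < n) a k) < a n.

Definition growing (phi : nat -> nat) : Prop :=
  {homo phi : x y / x <= y} /\ forall x, x <= phi x.

Definition rung (a : nat -> nat) u v : Prop := v = a u \/ u = a v.

Definition clique (m u v : nat) : Prop := u < m /\ v < m.

Lemma growingD phi c : growing phi -> growing (fun x => phi x + c).
Proof.
move=> [phm phi_ge]; split=> [x y xy|x]; first by rewrite leq_add2r phm.
exact: leq_trans (phi_ge x) (leq_addr _ _).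
Qed.

Lemma sum_ge (a : nat -> nat) k n : k < n -> a k <= \sum_(i < n) a i.
Proof. by move=> kn; rewrite (bigD1 (Ordinal kn)) //= leq_addr. Qed.

Lemma sparse_gt phi a n : growing phi -> sparse phi a -> n + \sum_(k < n) a k < a n.
Proof.
move=> gphi /(_ n); apply: leq_ltn_trans.
have [hm hi] := growingD n gphi.
exact: (@leq_iter id _ 0 n).
Qed.

Lemma sparse_inj phi a : growing phi -> sparse phi a -> injective a.
Proof.
move=> gphi sa; have lt k n : k < n -> a k < a n.
  move=> kn; apply: leq_ltn_trans (sparse_gt n gphi sa).
  by rewrite (leq_trans (sum_ge a kn)) ?leq_addl.
move=> p q apq; apply/eqP; case: ltngtP => // /lt; rewrite apq ltnn //.
Qed.

(** The rungs are removed from the top down.  [far] excludes that a walk with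
    close ends crosses its highest rung n -- a n when n is at least n0; in
    the definition of n0, the term l + l.+1 counts l steps from n to x, one jump
    to the close point y and l steps from y to a n.  The rungs below n0 are
    finitely many and are swallowed by a clique. *)
Lemma remove_rungs (e : nat -> nat -> Prop) phi a c l :
    growing phi -> sparse phi a ->
    (forall x, e x x) -> (forall x y, e x y -> e y x) ->
    (forall x y, e x y -> y <= phi x + c) ->
  exists m, forall x y, x <= phi y + c -> y <= phi x + c ->
    walk (fun u v => e u v \/ rung a u v) l x y ->
    walk (fun u v => e u v \/ clique m u v) l x y.
Proof.
move=> gphi sa er es ec.
pose R n u v := e u v \/ exists2 k, k < n & (u = k /\ v = a k) \/ (u = a k /\ v = k).
have Rr n x : R n x x by left.
have Rs n x y : R n x y -> R n y x.
  by case=> [/es|[k kn [[-> ->]|[-> ->]]]]; [left|right; exists k; auto..].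
pose n0 := maxn c (l + l.+1).
pose psi x := phi x + c.
have [psim psii] : growing psi by exact: growingD.
have far n x y : n0 <= n -> y <= psi x -> walk (R n) l x n ->
    walk (R n) l (a n) y -> False.
  move=> n0n yx /(walk_sym (@Rs n)) nx /(walk_sym (@Rs n)) yan.
  pose w := n + \sum_(k < n) a k.
  (* Every edge is dominated by psi, except the rungs below n, which stay below w. *)
  have Rb p q : R n p q -> q <= maxn (psi p) w.
    have := leq_maxl (psi p) w; have := leq_maxr (psi p) w.
    rewrite /psi {}/w => ? ? [/ec|[k kn H]]; first by lia.
    by have := sum_ge a kn; case: H => [[_ ->]|[_ ->]]; lia.
  have xw : x <= iter l psi w.
    by apply: (walk_bound psim psii Rb) nx => //; rewrite leq_addr.
  have yw : y <= iter l.+1 psi w by apply: leq_trans yx (psim _ _ xw).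
  have : a n <= iter l psi (iter l.+1 psi w).
    apply: (walk_bound psim psii Rb) yan => //.
    exact: (@leq_iter id _ 0).
  rewrite leqNgt -iterD => /negP; apply; apply: leq_ltn_trans (sa n).
  have [hm hi] := growingD n gphi.
  apply: leq_iter => //; last by apply: leq_trans n0n; rewrite leq_maxr.
  by move=> p; rewrite leq_add2l (leq_trans _ n0n) ?leq_maxl.
have step n x y : n0 <= n -> x <= psi y -> y <= psi x ->
    walk (R n.+1) l x y -> walk (R n) l x y.
  move=> n0n xy yx xy1.
  have [] // := @walk_add_edge _ (R n) n (a n) l x y (Rr n).
  - apply: sub_walk xy1 => u v [uv|[k]]; first by left; left.
    rewrite ltnS leq_eqVlt => /predU1P[-> []|kn]; [by auto..|].
    by left; right; exists k.
  - by case=> xn any; case: (far n x y).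
  - case=> /(walk_sym (@Rs n)) anx /(walk_sym (@Rs n)) yn.
    by case: (far n y x).
exists (n0 + \sum_(k < n0) a k).+1 => x y xy yx wxy.
(* A single walk uses finitely many rungs, so it has a highest one. *)
have [N wN] : exists N, walk (R N) l x y.
  elim: (l) x wxy {xy yx} => [|k IH] x /=; first by exists 0.
  case=> z xz /IH [N zy].
  have [k' xz'] : exists k', R k' x z.
    case: xz => [|[->|->]]; first by exists 0; left.
      by exists x.+1; right; exists x; auto.
    by exists z.+1; right; exists z; auto.
  have RR p q : p <= q -> forall u v, R p u v -> R q u v.
    move=> pq u v [|[i ip H]]; [by left|right; exists i => //].
    exact: leq_trans ip pq.
  exists (maxn k' N); exists z; first by apply: RR xz'; rewrite leq_maxl.
  by apply: sub_walk zy; apply: RR; rewrite leq_maxr.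
have {wN} wN : walk (R (n0 + N)) l x y.
  apply: sub_walk wN => u v [|[i iN H]]; [by left|right; exists i => //].
  by rewrite (leq_trans iN) ?leq_addl.
have {wN} : walk (R n0) l x y.
  elim: N wN => [|N IH]; first by rewrite addn0.
  by rewrite addnS => /step wN; apply/IH/wN => //; rewrite leq_addr.
apply: sub_walk => u v [|[k kn H]]; [by left|right].
have := sum_ge a kn; rewrite /clique; case: H => [[-> ->]|[-> ->]]; lia.
Qed.

(** * Removing finitely many ladders *)

Lemma le_starP f g : le_star f g -> exists c, forall n, f n <= g n + c.
Proof.
move/finite_seqP => [s sE]; exists (\sum_(k <- s) f k) => n.
have [|/negP ng] := boolP (f n <= g n); first by move/leq_trans; apply; rewrite leq_addr.
have ns : n \in s by have : [set` s] n by rewrite -sE.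
by rewrite (big_rem n) //= addnCA leq_addr.
Qed.

Definition graph (T : eqType) (a : T -> nat -> nat) (F : seq T) m u v : Prop :=
  u = v \/ clique m u v \/ exists2 t, t \in F & rung (a t) u v.

Lemma graph_refl (T : eqType) (a : T -> nat -> nat) F m u : graph a F m u u.
Proof. by left. Qed.

Lemma graph_sym (T : eqType) (a : T -> nat -> nat) F m u v :
  graph a F m u v -> graph a F m v u.
Proof.
case=> [->|[[um vm]|[t tF [->|->]]]]; [by left|by right; left|..];
  by right; right; exists t => //; rewrite /rung; auto.
Qed.

Lemma sub_graph (T : eqType) (a : T -> nat -> nat) F G m n u v :
  {subset F <= G} -> m <= n -> graph a F m u v -> graph a G n u v.
Proof.
move=> FG mn [->|[[um vm]|[t tF uv]]]; first by left.
  by right; left; split; exact: leq_trans mn.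
by right; right; exists t => //; exact: FG.
Qed.

Lemma seq_max (T : eqType) (lt : T -> T -> Prop) (F : seq T) x :
    (forall x y z, lt x y -> lt y z -> lt x z) ->
    (forall x y, [\/ lt x y, x = y | lt y x]) ->
  exists2 t, t \in x :: F & forall s, s \in x :: F -> s = t \/ lt s t.
Proof.
move=> ltt ltT; elim: F x => [|y F IH] x.
  by exists x; rewrite ?mem_head// => s; rewrite inE => /eqP; left.
have [t tF tm] := IH y; have [xt|xt|tx] := ltT x t.
- exists t; first by rewrite inE tF orbT.
  by move=> s; rewrite inE => /predU1P[->|/tm //]; right.
- exists t; first by rewrite inE tF orbT.
  by move=> s; rewrite inE => /predU1P[->|/tm //]; left.
- exists x; first by rewrite mem_head.
  move=> s; rewrite inE => /predU1P[->|/tm[->|st]]; [by left|by right|].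
  by right; exact: ltt tx.
Qed.

Lemma le_star_family (T : eqType) (a : T -> nat -> nat) phi (F : seq T) :
  (forall s, s \in F -> le_star (a s) phi) ->
  exists c, forall s n, s \in F -> a s n <= phi n + c.
Proof.
elim: F => [|t F IH] le; first by exists 0.
have [|c cF] := IH; first by move=> s sF; apply: le; rewrite inE sF orbT.
have [d dt] := le_starP (le t (mem_head _ _)).
exists (c + d) => s n; rewrite inE => /predU1P[->|sF]; first by have := dt n; lia.
by have := cF s n sF; lia.
Qed.

(** Each ladder is sparse relative to all earlier ladders and to B
    simultaneously: phi depends on t. *)
Definition ladder_system (T : eqType) (lt : T -> T -> Prop)
    (B : set (nat -> nat)) (a : T -> nat -> nat) : Prop :=
  forall t, exists phi, [/\ growing phi, sparse phi (a t),
    forall s, lt s t -> le_star (a s) phi & forall b, B b -> le_star b phi].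

(** Only the lt-largest ladder is known to be sparse relative to all the others,
    so it is removed first.  The clique left over from it is bounded, hence does
    no harm in the next round. *)
Lemma remove_all_rungs (T : eqType) (lt : T -> T -> Prop) B (a : T -> nat -> nat)
    b F m l :
    (forall x y z, lt x y -> lt y z -> lt x z) ->
    (forall x y, [\/ lt x y, x = y | lt y x]) ->
    ladder_system lt B a -> B b ->
  exists n, forall x y, x <= y <= b x ->
    walk (graph a F m) l x y -> walk (graph a [::] n) l x y.
Proof.
move=> ltt ltT la Bb.
have [k] := ubnP (size F); elim: k F m => // k IH [|x0 F] m sF; first by exists m.
have [t tF tm] := seq_max F x0 ltt ltT.
set G := x0 :: F in sF tF tm.
pose G' := [seq s <- G | s != t].
have sG' : size G' < k.
  rewrite size_filter -ltnS; apply: leq_trans sF; rewrite ltnS.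
  have : 0 < count (pred1 t) G by rewrite -has_count has_pred1.
  rewrite -(count_predC (pred1 t) G) => t_gt0.
  by rewrite -[X in X < _]add0n ltn_add2r.
have [phi [gphi sa dom domB]] := la t.
have ltG' s : s \in G' -> lt s t.
  by rewrite mem_filter => /andP[/eqP st /tm[]].
have [c ca] := le_star_family (fun s sG => dom s (ltG' s sG)).
have [d db] := le_starP (domB b Bb).
have G'c x y : graph a G' m x y -> y <= phi x + (m + c + d).
  case=> [->|[[um vm]|[s sG [->|->]]]].
  - by have := gphi.2 y; lia.
  - by lia.
  - by have := ca s x sG; lia.
  - have [psi [gpsi ssa _ _]] := la s.
    by have := sparse_gt y gpsi ssa; have := gphi.2 (a s y); lia.
have [p phip] := remove_rungs l gphi sa
  (graph_refl a G' m) (@graph_sym _ a G' m) G'c.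
have [n nP] := IH G' (maxn m p) sG'.
exists n => x y xyb wxy; apply: nP => //.
have {wxy} : walk (fun u v => graph a G' m u v \/ clique p u v) l x y.
  move/andP: xyb => [xy yb]; apply: phip.
  - by have := gphi.2 y; lia.
  - by have := db x; lia.
  - apply: sub_walk wxy => u v [->|[uv|[s sG uv]]].
    + by left; left.
    + by left; right; left.
    + have [st|st] := eqVneq s t; first by right; rewrite -st.
      by left; right; right; exists s; rewrite // mem_filter st.
apply: sub_walk => u v [|[um vm]]; first by apply: sub_graph; rewrite ?leq_maxl.
by right; left; split; rewrite leq_max ?um ?vm orbT.
Qed.

Lemma walk_clique (T : eqType) (a : T -> nat -> nat) n l x y :
  walk (graph a [::] n) l x y -> x = y \/ clique n x y.
Proof.
elim: l x => [|l IH] x /=; first by left.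
case=> z xz /IH zy; case: xz => [->//|[xz|[t]]]; last by rewrite in_nil.
by right; case: zy xz => [->//|[_ yn] [xn _]].
Qed.

(** * A well-order with small initial segments *)

(** This is the order type of the initial ordinal of T, obtained without
    ordinals: in an arbitrary well-order, either all initial segments are
    small, or T injects into the least one that is not, and the order
    is pulled back along this injection. *)
Lemma small_initial_segments (T : pointedType) :
  exists lt : T -> T -> Prop, [/\ well_founded lt,
    forall x y z, lt x y -> lt y z -> lt x z,
    forall x y, [\/ lt x y, x = y | lt y x] &
    forall t, ~ ([set: T] #<= [set s | lt s t])].
Proof.
have [R Rwo] := well_ordering_principle T.
pose S x y : Prop := R x y /\ x <> y.
have minR (A : set T) : A !=set0 -> exists2 z, A z & forall x, A x -> R z x.
  move=> [x Ax]; have [|z [[zA zm] _]] := Rwo [pred y | y \in A].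
    by exists x; apply/mem_set.
  exists z; first exact: set_mem.
  by move=> y Ay; apply: zm; apply/mem_set.
have Rch : wo_chain R predT := withinW Rwo.
have Ras x y : R x y -> R y x -> x = y.
  by move=> xy yx; apply: (wo_chain_antisymmetric Rch); rewrite // xy.
have Rtot x y : R x y \/ R y x by apply/orP; exact: (wo_chainW Rch).
have Rt x y z : R x y -> R y z -> R x z.
  move=> xy yz; have [_ [->|->|->] zm] :=
    minR [set w | [\/ w = x, w = y | w = z]] (ex_intro _ x (Or31 _ _ erefl)).
  - by apply: zm; constructor 3.
  - have -> : x = y by apply: Ras => //; apply: zm; constructor 1.
    exact: yz.
  - have <- : y = z by apply: Ras => //; apply: zm; constructor 2.
    exact: xy.
have Swf : well_founded S.
  move=> x; apply: contrapT => nx.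
  have [z nz zm] := minR [set w | ~ Acc S w] (ex_intro _ x nx).
  apply: nz; split=> y [yz yNz]; apply: contrapT => /zm zy.
  by apply: yNz; exact: Ras.
have [f [finj fsmall]] : exists f : T -> T,
    injective f /\ forall t, ~ ([set: T] #<= [set s | S s (f t)]).
  have [[t tbig]|nbig] := pselect (exists t, [set: T] #<= [set s | S s t]); last first.
    by exists id; split=> // t tb; apply: nbig; exists t.
  have [z zbig zm] := minR [set t | [set: T] #<= [set s | S s t]]
    (ex_intro _ t tbig).
  have /pcard_leP/unsquash f := zbig.
  exists f; split=> [x y|x /zm zx]; first by apply: inj; rewrite inE.
  have [fz fNz] : S (f x) z by exact: (@funS _ _ _ _ f).
  by apply: fNz; exact: Ras.
exists (fun x y => S (f x) (f y)); split.
- exact: (Inverse_Image.wf_inverse_image _ _ S f).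
- move=> x y z [xy xNy] [yz yNz]; split; first exact: Rt yz.
  by move=> xz; apply: xNy; apply: Ras => //; rewrite xz.
- move=> x y; have [->|xy] := eqVneq x y; first by constructor 2.
  have fxy : f x <> f y by move/finj => e; rewrite e eqxx in xy.
  by have [?|?] := Rtot (f x) (f y); [constructor 1|constructor 3];
    split=> // e; apply: fxy.
- move=> t tbig; apply: (fsmall t); apply: card_le_trans tbig _.
  set A := [set s | S (f s) _].
  have /card_eqPle[_ AfA] : f @` A #= A by apply: inj_card_eq => x y _ _ /finj.
  by apply: card_le_trans AfA _; apply: subset_card_le => _ [s + <-].
Qed.

(** * Choosing the ladders *)

Lemma finite_set_bounded (A : set nat) :
  finite_set A -> exists N, forall n, A n -> n < N.
Proof.
move=> /finite_seqP[s ->]; exists (\sum_(k <- s) k).+1 => n /= ns.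
by rewrite ltnS (big_rem n) //= leq_addr.
Qed.

Lemma infinite_set_unbounded (A : set nat) :
  infinite_set A -> forall N, exists2 n, A n & N < n.
Proof.
move=> infA N; apply: contrapT => nA; apply: infA.
apply: (sub_finite_set _ (finite_II N.+1)) => n An /=; rewrite ltnS leqNgt.
by apply/negP => Nn; apply: nA; exists n.
Qed.

Lemma sparse_sequence_in (A : set nat) phi :
  infinite_set A -> exists2 a, sparse phi a & forall n, A (a n).
Proof.
move=> /infinite_set_unbounded/(_ _)/cid2 next.
pose nxt N := s2val (next N).
(* s stands for the sum of the earlier terms, which is all that the choice of
   the next term depends on. *)
pose g n s := nxt (iter n (fun x => phi x + n) (n + s)).
pose fix sum n := if n is k.+1 then sum k + g k (sum k) else 0.
exists (fun n => g n (sum n)) => n; last exact: (s2valP (next _)).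
suff -> : \sum_(k < n) g k (sum k) = sum n by exact: (s2valP' (next _)).
by elim: n => [|n IH]; [rewrite big_ord0|rewrite big_ord_recr /= IH].
Qed.

Lemma small_family_dominated (U : set (nat -> nat)) :
    (forall V, star_unbounded V -> continuum #<= V) -> ~ (continuum #<= U) ->
  exists2 phi, growing phi & forall f, U f -> le_star f phi.
Proof.
move=> bc Usmall; have [g Ug] : exists g, forall f, U f -> le_star f g.
  by apply: contrapT => /bc.
exists (fun n => n + \sum_(k < n.+1) g k).
  split=> [x y xy|x]; last exact: leq_addr.
  apply: leq_add => //; rewrite -(subnKC xy).
  elim: (y - x) => [|d IH]; first by rewrite addn0.
  by rewrite addnS [leqRHS]big_ord_recr /= (leq_trans IH) ?leq_addr.
move=> f /Ug; apply: sub_finite_set => n /= fn fgn; apply: fn.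
rewrite (leq_trans fgn) // (leq_trans _ (leq_addl _ _)) //.
exact: (@sum_ge g n n.+1).
Qed.

(** Well-founded recursion: when the ladder of t is chosen, there are fewer
    than c earlier ones, so these have a common bound phi; psi bounds the
    functions in B, and sparseness is required relative to phi + psi. *)
Lemma ladder_system_exists (B : set (nat -> nat)) :
    (forall V, star_unbounded V -> continuum #<= V) -> ~ (continuum #<= B) ->
  exists (lt : set nat -> set nat -> Prop) a,
    [/\ forall x y z, lt x y -> lt y z -> lt x z,
        forall x y, [\/ lt x y, x = y | lt y x],
        ladder_system lt B a
      & forall A, infinite_set A -> forall n, A (a A n)].
Proof.
move=> bc Bsmall.
have [lt [ltwf ltt ltT ltsmall]] := small_initial_segments (set nat).
have stepP t (r : set nat -> nat -> nat) : exists b, (exists phi,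
    [/\ growing phi, sparse phi b, forall s, lt s t -> le_star (r s) phi
      & forall f, B f -> le_star f phi])
    /\ (infinite_set t -> forall n, t (b n)).
  have [||phi gphi phiP] := @small_family_dominated (r @` [set s | lt s t]) => //.
    by move=> /card_le_trans/(_ (card_image_le _ _)); exact: ltsmall.
  have [psi gpsi psiP] := small_family_dominated bc Bsmall.
  pose chi x := phi x + psi x.
  have gchi : growing chi.
    split=> [x y xy|x]; first by apply: leq_add; [apply: gphi.1|apply: gpsi.1].
    by rewrite (leq_trans (gphi.2 x)) ?leq_addr.
  have [b sb bt] : exists2 b, sparse chi b & infinite_set t -> forall n, t (b n).
    have [/sparse_sequence_in - /(_ chi)[b sb bt]|nt] := pselect (infinite_set t).
      by exists b.
    by have [b sb _] := sparse_sequence_in chi infinite_nat; exists b.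
  exists b; split=> //; exists chi; split=> // [s st|f Bf].
    have /phiP : (r @` [set s | lt s t]) (r s) by exists s.
    apply: sub_finite_set => n /= rn le; apply: rn.
    by rewrite (leq_trans le) ?leq_addr.
  apply: sub_finite_set (psiP f Bf) => n /= rn le; apply: rn.
  by rewrite (leq_trans le) ?leq_addl.
pose step t r := sval (cid (stepP t r)).
(* Fix supplies values below t only; extending them by 0 makes step applicable. *)
pose ext t (r : forall s, lt s t -> nat -> nat) s :=
  if pselect (lt s t) is left st then r s st else fun=> 0.
pose a := Fix ltwf (fun=> nat -> nat) (fun t r => step t (ext t r)).
pose below t s := if pselect (lt s t) is left _ then a s else fun=> 0.
have aE t : a t = step t (below t).
  rewrite /a Fix_eq // => x f g fg; congr step; apply: funext => s.
  by rewrite /ext; case: pselect.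
exists lt, a; split=> // t; rewrite aE /step; case: cid => b [] //=.
move=> [phi [gphi sb rphi Bphi]] _; exists phi; split=> // s st.
by have := rphi s st; rewrite /below; case: pselect.
Qed.

(** * The coarse structure of a system of ladders *)

Definition bounded_degree (e : nat -> nat -> Prop) : Prop :=
  exists B (nb : nat -> seq nat),
    forall x, size (nb x) <= B /\ forall y, e x y -> y \in nb x.

Lemma bounded_degree_or (e f : nat -> nat -> Prop) :
  bounded_degree e -> bounded_degree f ->
  bounded_degree (fun x y => e x y \/ f x y).
Proof.
move=> [B [nb nbP]] [C [nc ncP]]; exists (B + C), (fun x => nb x ++ nc x) => x.
have [sb eb] := nbP x; have [sc ec] := ncP x; split.
  by rewrite size_cat leq_add.
by move=> y [/eb|/ec]; rewrite mem_cat => ->; rewrite ?orbT.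
Qed.

Lemma bounded_degree_walk e k : bounded_degree e -> bounded_degree (walk e k).
Proof.
move=> [B [nb nbP]]; elim: k => [|k [C [nc ncP]]].
  by exists 1, (fun x => [:: x]) => x; split=> // y /= ->; rewrite mem_head.
exists (B * C), (fun x => flatten [seq nc z | z <- nb x]) => x; split; last first.
  move=> y /= [z xz zy]; apply/flatten_mapP; exists z; first exact: (nbP x).2.
  exact: (ncP z).2.
apply: leq_trans (leq_mul (nbP x).1 (leqnn C)).
elim: (nb x) => //= z s IH; rewrite size_cat mulSn leq_add //.
exact: (ncP z).1.
Qed.

Lemma bounded_degree_rung a : injective a -> bounded_degree (rung a).
Proof.
move=> ainj; exists 2, (fun x => [:: a x; get [set y | a y = x]]) => x.
split=> // y; rewrite !inE => -[->|xE]; first by rewrite eqxx.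
apply/orP; right; apply/eqP/ainj; rewrite -xE.
by have := @getI _ [set z | a z = x] y (esym xE).
Qed.

Lemma bounded_degree_graph (T : eqType) (a : T -> nat -> nat) F m :
  (forall t, injective (a t)) -> bounded_degree (graph a F m).
Proof.
move=> ainj; apply: bounded_degree_or.
  by exists 1, (fun x => [:: x]) => x; split=> // y ->; rewrite mem_head.
apply: bounded_degree_or.
  exists m, (fun=> iota 0 m) => x; rewrite size_iota; split=> // y [_ ym].
  by rewrite mem_iota.
elim: F => [|t F [B [nb nbP]]].
  by exists 0, (fun=> [::]) => x; split=> // y [].
have [C [nc ncP]] := bounded_degree_or (bounded_degree_rung (ainj t))
  (ex_intro _ B (ex_intro _ nb nbP)).
exists C, nc => x; split; first exact: (ncP x).1.
move=> y [s]; rewrite inE => /predU1P[->|sF] xy; apply: (ncP x).2; first by left.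
by right; exists s.
Qed.

Definition ladder_coarse (T : eqType) (a : T -> nat -> nat) : set (set (nat * nat)) :=
  [set E | is_entourage E /\ exists F m l,
    forall x y, E (x, y) -> walk (graph a F m) l x y].

Lemma ladder_coarse_walk (T : eqType) (a : T -> nat -> nat) F m l :
  ladder_coarse a [set xy | walk (graph a F m) l xy.1 xy.2].
Proof.
split; last by exists F, m, l.
move=> [x y]; rewrite /diagonal /= => ->.
by apply: (@walk_leq _ _ 0) => //; exact: graph_refl.
Qed.

Lemma ladder_coarse_structure (T : eqType) (a : T -> nat -> nat) :
  is_coarse_structure (ladder_coarse a).
Proof.
split=> [E []//| |E F [dE [G [m [l Ew]]]] [dF [G' [m' [l' Fw]]]]|
  E F [_ [G [m [l Ew]]]] dF FE].
- apply/seteqP; split=> // -[x y] _.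
  exists [set xy | walk (graph a [::] (x + y).+1) 1 xy.1 xy.2].
    exact: ladder_coarse_walk.
  by exists y => //; right; left; rewrite /clique /=; lia.
- exists [set xy | walk (graph a (G ++ G') (maxn m m')) (l + l') xy.1 xy.2].
    exact: ladder_coarse_walk.
  move=> [x z] [y /= /Ew xy /Fw zy]; apply: walk_cat.
    apply: sub_walk xy => u v; apply: sub_graph; rewrite ?leq_maxl // => t tG.
    by rewrite mem_cat tG.
  apply: (walk_sym (@graph_sym _ a _ _)).
  apply: sub_walk zy => u v; apply: sub_graph; rewrite ?leq_maxr // => t tG.
  by rewrite mem_cat tG orbT.
- by split=> //; exists G, m, l => x y /FE /Ew.
Qed.

Lemma ladder_coarse_finitary (T : eqType) (a : T -> nat -> nat) :
  (forall t, injective (a t)) -> finitary (ladder_coarse a).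
Proof.
move=> ainj E [_ [F [m [l Ew]]]].
have [B [nb nbP]] := bounded_degree_walk l (bounded_degree_graph F m ainj).
exists B => x; have [sz inb] := nbP x.
apply: (@card_le_trans _ _ _ `I_(size (nb x))); last by rewrite card_le_II.
have xE y : xsection E x y -> y \in nb x by move/xsectionP/Ew/inb.
apply: (@card_le_trans _ _ _ [set` nb x]); first exact: subset_card_le.
have /card_eqPle[_ le] : (index^~ (nb x)) @` [set` nb x] #= [set` nb x].
  by apply: inj_card_eq => y z /set_mem yx /set_mem zx; exact: index_inj.
apply: card_le_trans le _; apply: subset_card_le => _ [y yx <-] /=.
by rewrite index_mem.
Qed.

Lemma finitary_bounded_finite (C : set (set (nat * nat))) A :
  finitary C -> coarse_bounded C A -> finite_set A.
Proof.
move=> fC [E /fC[n nE] [x Ax]]; apply/finite_set_leP; exists n.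
exact: card_le_trans (subset_card_le Ax) (nE x).
Qed.

(** Finite sets lie in a ball of a clique, so an unbounded set A is infinite,
    and every n is a neighbour of the element a A n of A. *)
Lemma ladder_coarse_large (a : set nat -> nat -> nat) :
    (forall t, injective (a t)) ->
    (forall A, infinite_set A -> forall n, A (a A n)) ->
  large (ladder_coarse a).
Proof.
move=> ainj aA; split.
  by move/(finitary_bounded_finite (ladder_coarse_finitary ainj))/infinite_nat.
move=> A Aunb; have infA : infinite_set A.
  move=> /finite_set_bounded[N AN]; apply: Aunb.
  exists [set xy | walk (graph a [::] N.+1) 1 xy.1 xy.2].
    exact: ladder_coarse_walk.
  exists 0 => n /AN nN; apply/xsectionP; exists n => //.
  by right; left; rewrite /clique /=; lia.
exists [set xy | walk (graph a [:: A] 0) 1 xy.1 xy.2].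
  exact: ladder_coarse_walk.
apply/seteqP; split=> // n _; exists (a A n); first exact: aA.
apply/xsectionP; exists n => //; right; right.
by exists A; rewrite ?mem_head //; right.
Qed.

(** * Counting large finitary structures *)

(** The even numbers form an unbounded set, so some entourage E links every
    odd number x to an even one p x.  Either of the two may be the smaller:
    b is obtained from p if x is, and from the finiteness of the ball
    E (p x) if p x is. *)
Lemma large_moves (C : set (set (nat * nat))) : finitary C -> large C ->
  exists b E, C E /\ forall m, exists x y,
    [/\ E (x, y), x <> y, m <= y & x <= y <= b x \/ y <= x <= b y].
Proof.
move=> fC [_ lC]; have [|E CE Eall] := lC [set n | ~~ odd n].
  move=> /(finitary_bounded_finite fC)/finite_set_bounded[N].
  by move=> /(_ N.*2); rewrite /= odd_double => /(_ isT); lia.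
have /choice[p pP] x : exists p, ~~ odd p /\ E (p, x).
  have [p pe] : ball_of_set E [set n | ~~ odd n] x by rewrite Eall.
  by move=> /xsectionP px; exists p.
have /choice[N NP] x : exists N, forall y, E (x, y) -> y < N.
  have [n nE] := fC E CE; have /finite_set_bounded[N Nx] : finite_set (xsection E x).
    by apply/finite_set_leP; exists n; exact: nE.
  by exists N => y xy; apply: Nx; apply/xsectionP.
exists (fun x => maxn (p x) (N x)), E; split=> // m.
have [pe px] := pP m.*2.+1; exists (p m.*2.+1), m.*2.+1; split=> //.
- by move=> e; rewrite e /= odd_double in pe.
- lia.
- have := NP _ _ px; have [/ltnW|] := ltnP m.*2.+1 (p m.*2.+1); lia.
Qed.

(** If the ladder structure belonged to K, its own entourage from
    [large_moves] would be covered by walks, hence by walks inside a finite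
    clique, which fix all large points. *)
Lemma large_finitary_outside (K : set (set (set (nat * nat)))) :
    (forall V, star_unbounded V -> continuum #<= V) -> ~ (continuum #<= K) ->
    (forall C, K C -> finitary C /\ large C) ->
  exists C, [/\ is_coarse_structure C, finitary C & large C] /\ ~ K C.
Proof.
move=> bc Ksmall KP.
have /choice[b bP] C : exists b, K C -> exists E, C E /\ forall m, exists x y,
    [/\ E (x, y), x <> y, m <= y & x <= y <= b x \/ y <= x <= b y].
  have [/KP[fC lC]|nK] := pselect (K C); last by exists id.
  by have [b bP] := large_moves fC lC; exists b.
have [||lt [a [ltt ltT la aA]]] := @ladder_system_exists (b @` K) => //.
  by move=> /card_le_trans/(_ (card_image_le _ _)).
have ainj t : injective (a t).
  by have [phi [gphi sa _ _]] := la t; exact: sparse_inj sa.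
exists (ladder_coarse a); split.
  split; [exact: ladder_coarse_structure|exact: ladder_coarse_finitary|].
  exact: ladder_coarse_large.
move=> KC; have [E [[_ [F [m [l Ew]]]] Emoves]] := bP _ KC.
have Bb : (b @` K) (b (ladder_coarse a)) by exists (ladder_coarse a).
have [n nP] := remove_all_rungs F m l ltt ltT la Bb.
have [x [y [/Ew xy xNy ny near]]] := Emoves n.
suff [//|[]] : x = y \/ clique n x y by lia.
case: near => /nP; first by move=> /(_ xy)/walk_clique.
move=> /(_ (walk_sym (@graph_sym _ a F m) xy))/walk_clique[->|[]]; first by left.
by right.
Qed.

Theorem corollary6p13 :
  has_card_b continuum ->
  exists S : set (set (set (nat * nat))),
    S #= continuum /\
    forall C, S C -> [/\ is_coarse_structure C, finitary C & large C].
Proof.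
move=> [_ bc]; pose K : set (set (set (nat * nat))) :=
  [set C | [/\ is_coarse_structure C, finitary C & large C]].
have /pcard_leP/unsquash f : continuum #<= K.
  apply: contrapT => Ksmall.
  have [|C [KC nKC]] := large_finitary_outside bc Ksmall.
    by move=> C [].
  exact: nKC KC.
exists (f @` continuum); split; first exact: card_image.
by move=> _ [A _ <-]; exact: (@funS _ _ _ _ f).
Qed.
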